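(* Let $\mathbb{K}$ be an algebraically closed field and let $e\ge 3$ be an integer. Let $S_1, S_2\subset\mathbb{P}^{e+2}$ be the non-normal del Pezzo surfaces over $\mathbb{K}$ with homogeneous ideals in $\mathbb{K}[z_0,\ldots,z_{e+2}]$ $$I(S_1)=\langle z_iz_{j+1}-z_{i+1}z_j\ (2\le i<j\le e+1),\ z_2z_{i-1}+z_1z_i-z_0z_{i+1}\ (3\le i\le e+1)\rangle,$$ $$I(S_2)=\langle z_iz_{j+1}-z_{i+1}z_j\ (2\le i<j\le e+1),\ z_1z_{i-1}-z_0z_{i+1}\ (3\le i\le e+1)\rangle,$$ and let $T\subset\mathbb{P}^{e+3}$ be the non-normal del Pezzo threefold with homogeneous ideal in $\mathbb{K}[z_0,\ldots,z_{e+3}]$ $$I(T)=\langle z_iz_{j+1}-z_{i+1}z_j\ (3\le i<j\le e+2),\ z_1z_{i-1}+z_0z_i-z_2z_{i+1}\ (4\le i\le e+2)\rangle.$$ Then: (1) $\text{rank-index}(S_1)=5$; (2) $\text{rank-index}(S_2)=4$; (3) $\text{rank-index}(T)=6$.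
   Context: The three displayed ideals are known to be prime, and the displayed generators are $\mathbb{K}$-linearly independent. A projective variety of codimension $e$ and degree $d$ is called a del Pezzo variety if it is arithmetically Cohen–Macaulay and $d=e+2$; the varieties $S_1,S_2,T$ are non-normal del Pezzo varieties of codimension $e$. The rank of a quadratic form is the rank of its associated symmetric matrix. For a variety $X$ whose homogeneous ideal $I(X)$ is generated by quadratic forms, $\text{rank-index}(X)$ is the smallest integer $k$ such that $I(X)$ can be generated by quadratic forms of rank at most $k$.
   Formalization: The field K is additionally assumed to have characteristic different from 2, since the rank of a quadratic form via its associated symmetric matrix is undefined in characteristic 2 (for example for z_0z_1). *)

(* Defs.v *)
From mathcomp Require Import all_boot all_order all_algebra.
From mathcomp Require Import mpoly.

Set Implicit Arguments.
Unset Strict Implicit.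
Unset Printing Implicit Defensive.

Import GRing.Theory.

Local Open Scope ring_scope.

Section Ideals.

Variables (K : fieldType) (n : nat).

Definition ideal_gen (G : {mpoly K[n]} -> Prop) (p : {mpoly K[n]}) : Prop :=
  exists2 s : seq ({mpoly K[n]} * {mpoly K[n]}),
    forall c, c \in s -> G c.2 & p = \sum_(c <- s) c.1 * c.2.

(* The symmetric matrix A with q = \sum_(i, j) A i j 'X_i 'X_j; this makes
   sense for q of degree 2 when 2 is invertible, see [quad_mxE]. *)
Definition quad_mx (q : {mpoly K[n]}) : 'M[K]_n :=
  \matrix_(i, j) (q@_(U_(i) + U_(j)) / (if i == j then 1 else 2)).

Definition quad_rank (q : {mpoly K[n]}) : nat := \rank (quad_mx q).

Lemma quad_mx_sym (q : {mpoly K[n]}) : (quad_mx q)^T = quad_mx q.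
Proof. by apply/matrixP=> i j; rewrite !mxE addmC eq_sym. Qed.

Lemma quad_mxE (q : {mpoly K[n]}) : 2%N \notin [pchar K] -> q \is 2.-homog ->
  q = \sum_(i < n) \sum_(j < n) quad_mx q i j *: ('X_i * 'X_j).
Proof.
move=> char2 q2; have n2 : (2 : K) != 0 by apply: contra char2; rewrite inE.
have coefE (m : 'X_{1..n}) (i j : 'I_n) :
    (quad_mx q i j *: ('X_i * 'X_j))@_m =
    (if (U_(i) + U_(j))%MM == m then quad_mx q i j else 0).
  rewrite mcoeffZ -mpolyXD mcoeffX.
  by case: eqP => _; rewrite ?mulr1 ?mulr0.
apply/mpolyP=> m; rewrite raddf_sum /=.
under eq_bigr => i _ do (rewrite raddf_sum /=; under eq_bigr do rewrite coefE).
have [m2|m2] := eqVneq (mdeg m) 2%N; last first.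
  rewrite (dhomog_nemf_coeff q2 m2) big1 // => i _; rewrite big1 // => j _.
  by case: eqP => // e; case/eqP: m2; rewrite -e mdegD !mdeg1.
have [a ma] : exists a, (0 < m a)%N.
  apply/existsP; apply: contraT; rewrite negb_exists => /forallP m0.
  suff : mdeg m = 0%N by rewrite m2.
  apply/eqP; rewrite mdeg_eq0; apply/eqP/mnmP=> i; rewrite mnm0E.
  by have := m0 i; rewrite lt0n negbK => /eqP.
have leam : (U_(a) <= m)%MM.
  by apply/mnm_lepP=> i; rewrite mnm1E; case: eqP => // <-.
have /mdeg1P[b /eqP mb] : mdeg (m - U_(a))%MM == 1%N.
  by have := mdegD (m - U_(a)) U_(a); rewrite submK // m2 mdeg1 addn1 => -[<-].
have mE : m = (U_(a) + U_(b))%MM by rewrite -mb addmC submK.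
have eqU (i j : 'I_n) : ((U_(i) + U_(j))%MM == m) =
    ((i == a) && (j == b)) || ((i == b) && (j == a)).
  rewrite mE; apply/eqP/idP=> [/mnmP e|]; last first.
    by case/orP=> /andP[/eqP-> /eqP->] //; rewrite addmC.
  move: (e i) (e j) (e a) (e b); rewrite !mnmDE !mnm1E !eqxx.
  rewrite (eq_sym a i) (eq_sym a j) (eq_sym b i) (eq_sym b j).
  case: (eqVneq i a) => [->|_]; case: (eqVneq j b) => [->|_] //=;
  case: (i == b); case: (j == a); by do ?case: (_ == _).
under eq_bigr => i _ do under eq_bigr => j _ do rewrite eqU.
have [eab|nab] := eqVneq a b.
  rewrite (bigD1 a) //= (bigD1 b) //= !eqxx /= big1 ?addr0; last first.
    by move=> j /negPf nj; rewrite eab nj andbF /=.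
  rewrite big1 ?addr0; last first.
    move=> i /negPf ni; rewrite big1 // => j _.
    by rewrite -eab ni.
  by rewrite !mxE eab eqxx divr1 mE eab.
have nba : b != a by rewrite eq_sym.
rewrite (bigD1 a) //= (bigD1 b) //= !eqxx /= big1 ?addr0; last first.
  by move=> j /negPf nj; rewrite nj (negPf nab).
rewrite (bigD1 b) //= (bigD1 a) //= !eqxx (negPf nba) /= big1 ?addr0; last first.
  by move=> j /negPf nj; rewrite nj.
rewrite big1 ?addr0; last first.
  by move=> i /andP[/negPf ni /negPf nj]; rewrite big1 // => j _; rewrite ni nj.
rewrite !mxE (negPf nab) (negPf nba) (addmC (mnm1 b)) -mE -mulrDr.
by rewrite -mulr2n -(mulr_natr (2^-1)) mulVf // mulr1.
Qed.

End Ideals.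

Section Varieties.

Variables (K : fieldType) (n : nat).

(* Points of P^n are given by homogeneous coordinates: a subset of P^n is a
   set of nonzero coordinate vectors.  [proj_closed] makes it the zero locus of
   a set of forms, so that it is automatically stable under scaling. *)
Implicit Types X Y : ('I_n.+1 -> K) -> Prop.

Definition proj_closed X : Prop :=
  exists2 F : {mpoly K[n.+1]} -> Prop, forall f, F f -> f \is homog mdeg
    & forall x, X x <-> (exists i, x i != 0) /\ (forall f, F f -> f.@[x] = 0).

Definition irreducible X : Prop :=
  (exists x, X x) /\
  forall Y Z, proj_closed Y -> proj_closed Z ->
    (forall x, X x -> Y x \/ Z x) ->
    (forall x, X x -> Y x) \/ (forall x, X x -> Z x).

Definition proj_variety X : Prop := proj_closed X /\ irreducible X.

Definition homog_ideal X : {mpoly K[n.+1]} -> Prop :=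
  ideal_gen (fun f => f \is homog mdeg /\ forall x, X x -> f.@[x] = 0).

Definition generated_in_rank X (k : nat) : Prop :=
  exists2 G : {mpoly K[n.+1]} -> Prop,
    forall q, G q -> q \is 2.-homog /\ (quad_rank q <= k)%N
    & forall p, homog_ideal X p <-> ideal_gen G p.

Definition is_rank_index X (k : nat) : Prop :=
  generated_in_rank X k /\ forall l, generated_in_rank X l -> (k <= l)%N.

End Varieties.

Section Equations.

Variables (K : fieldType).

Definition z n (i : nat) : {mpoly K[n.+1]} := 'X_(inord i).

Definition S1_eqs e (p : {mpoly K[e.+3]}) : Prop :=
  (exists i j : nat, (2 <= i < j)%N /\ (j <= e.+1)%N /\
     p = z _ i * z _ j.+1 - z _ i.+1 * z _ j) \/
  (exists i : nat, (3 <= i <= e.+1)%N /\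
     p = z _ 2 * z _ i.-1 + z _ 1 * z _ i - z _ 0 * z _ i.+1).

Definition S2_eqs e (p : {mpoly K[e.+3]}) : Prop :=
  (exists i j : nat, (2 <= i < j)%N /\ (j <= e.+1)%N /\
     p = z _ i * z _ j.+1 - z _ i.+1 * z _ j) \/
  (exists i : nat, (3 <= i <= e.+1)%N /\
     p = z _ 1 * z _ i.-1 - z _ 0 * z _ i.+1).

Definition T_eqs e (p : {mpoly K[e.+4]}) : Prop :=
  (exists i j : nat, (3 <= i < j)%N /\ (j <= e.+2)%N /\
     p = z _ i * z _ j.+1 - z _ i.+1 * z _ j) \/
  (exists i : nat, (4 <= i <= e.+2)%N /\
     p = z _ 1 * z _ i.-1 + z _ 0 * z _ i - z _ 2 * z _ i.+1).

End Equations.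

(* Main.v *)
(* The symmetric matrix A of a quadric q in the ideal depends linearly on q, so
   the linear relations between its entries can be read off the generators.
   If m is the least index with A_(1,m) <> 0, these relations make a submatrix
   of A triangular with nonzero diagonal: a 6 x 6 one for T, a 4 x 4 one for S2
   and a 5 x 5 one for S1.  Hence quadrics of smaller rank in the ideal do not
   involve the product of z_1 with any variable, and cannot generate it.
   For S1 the generators Q_i with i > 3 have rank 6; modulo the scroll equations
   Q_3 + Q_i = L^2 + (z_1 - z_(i-2)) M - z_0 N with L = z_2 + z_(i-1),
   M = z_3 + z_i and N = z_4 + z_(i+1), which has rank at most 5. *)
From HB Require Import structures.
Require Import Defs.
From mathcomp Require Import all_boot all_order all_algebra.
From mathcomp Require Import mpoly.
From mathcomp Require Import ring zify.

Set Implicit Arguments.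
Unset Strict Implicit.
Unset Printing Implicit Defensive.

Import GRing.Theory.

Local Open Scope ring_scope.

(** * Rank bounds from triangular submatrices *)

Section Rank.

Variable K : fieldType.

(** The selected [r] by [r] submatrix is lower triangular with nonzero diagonal, hence invertible,
    and extracting rows and columns cannot raise the rank. *)
Lemma rank_trig_submx m n r (A : 'M[K]_(m, n)) (f : 'I_r -> 'I_m)
    (g : 'I_r -> 'I_n) :
  (forall i j : 'I_r, (i < j)%N -> A (f i) (g j) = 0) ->
  (forall i, A (f i) (g i) != 0) -> (r <= \rank A)%N.
Proof.
move=> A0 A1; pose B := mxsub f g A.
have trigB : is_trig_mx B by apply/is_trig_mxP => i j ij; rewrite mxE A0.
have unitB : B \in unitmx.
  rewrite unitmxE det_trig // unitfE; apply/prodf_neq0 => i _.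
  by rewrite mxE A1.
rewrite -(mxrank_unit unitB) /B mxsubrc.
apply: leq_trans (mxrankS (rowsub_sub _ _)) _.
by rewrite -[A in colsub g A]mulmx1 -mulmx_colsub mxrankM_maxl.
Qed.
End Rank.

(** * Matrices of quadrics, products of linear forms, and quadrics in an ideal *)

Section QuadMx.

Variables (K : fieldType) (n : nat).
Implicit Types (p q : {mpoly K[n]}) (G : {mpoly K[n]} -> Prop).

Lemma quad_mxP a p q : quad_mx (a *: p + q) = a *: quad_mx p + quad_mx q.
Proof. by apply/matrixP => i j; rewrite !mxE mcoeffD mcoeffZ mulrDl mulrA. Qed.

HB.instance Definition _ :=
  GRing.isLinear.Build K {mpoly K[n]} 'M[K]_n _ (@quad_mx K n) quad_mxP.

Hypothesis charK : 2%N \notin [pchar K].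

Lemma two_neq0 : (2 : K) != 0.
Proof. by apply: contra charK; rewrite inE. Qed.

Lemma half_double (c : K) : 2^-1 * (c + c) = c.
Proof. by rewrite -mulr2n -[c *+ 2]mulr_natl mulKf // two_neq0. Qed.

(** If [a = b] the two deltas coincide, and their double cancels the factor [2^-1]; this matches the
    division by 1 on the diagonal in [quad_mx]. *)
Lemma quad_mxXX (a b : 'I_n) :
  quad_mx ('X_a * 'X_b : {mpoly K[n]}) = 2^-1 *: (delta_mx a b + delta_mx b a).
Proof.
have n2 := two_neq0.
apply/matrixP => i j; rewrite !mxE -mpolyXD mcoeffX.
have -> : ((U_(a) + U_(b))%MM == (U_(i) + U_(j))%MM) =
    ((a == i) && (b == j)) || ((a == j) && (b == i)).
  apply/eqP/idP => [/mnmP e|]; last first.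
    by case/orP=> /andP[/eqP-> /eqP->] //; rewrite addmC.
  move: (e i) (e j) (e a) (e b); rewrite !mnmDE !mnm1E !eqxx.
  rewrite (eq_sym i a) (eq_sym i b) (eq_sym j a) (eq_sym j b).
  case: (eqVneq a i) => [->|_]; case: (eqVneq b j) => [->|_] //=;
  case: (b == i); case: (a == j); by do ?case: (_ == _).
rewrite !(eq_sym i) !(eq_sym j).
have [eij|nij] := eqVneq i j.
  rewrite -eij orbb divr1 [(b == i) && _]andbC.
  by rewrite half_double.
have [/= eai|_] := eqVneq a i; have [/= ebj|_] := eqVneq b j;
  have [/= eaj|_] := eqVneq a j; have [/= ebi|_] := eqVneq b i => //=;
  rewrite ?add0r ?addr0 ?mul0r ?mulr0 ?mul1r ?mulr1 //;
  by case/eqP: nij; congruence.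
Qed.

(** Linear forms are given by coefficient rows, so that a product of two of them has a sum of two
    outer products as its matrix. *)
Definition lin (u : 'rV[K]_n) : {mpoly K[n]} := \sum_i u 0 i *: 'X_i.

Lemma linP a u v : lin (a *: u + v) = a *: lin u + lin v.
Proof.
rewrite /lin scaler_sumr -big_split /=; apply: eq_bigr => i _.
by rewrite !mxE scalerDl scalerA.
Qed.

HB.instance Definition _ :=
  GRing.isLinear.Build K 'rV[K]_n {mpoly K[n]} _ lin linP.

Lemma lin_delta i : lin (delta_mx 0 i) = 'X_i.
Proof.
rewrite /lin (bigD1 i) //= mxE !eqxx scale1r big1 ?addr0 // => j nj.
by rewrite mxE (negPf nj) andbF scale0r.
Qed.

Lemma quad_mx_lin_mul u v :
  quad_mx (lin u * lin v) = 2^-1 *: (u^T *m v + v^T *m u).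
Proof.
rewrite /lin mulr_suml linear_sum /=.
under eq_bigr => i _.
  rewrite mulr_sumr linear_sum /=.
  under eq_bigr => j _ do
    rewrite -scalerAl -scalerAr scalerA linearZ /= quad_mxXX.
  over.
apply/matrixP => k l; rewrite summxE.
under eq_bigr => i _.
  rewrite summxE; under eq_bigr => j _ do rewrite !mxE.
  over.
rewrite !mxE !big_ord1 !mxE.
transitivity (2^-1 * (\sum_i \sum_j u 0 i * v 0 j * ((k == i) && (l == j))%:R +
   \sum_i \sum_j u 0 i * v 0 j * ((k == j) && (l == i))%:R)).
  rewrite -big_split mulr_sumr; apply: eq_bigr => i _ /=.
  by rewrite -big_split mulr_sumr; apply: eq_bigr => j _ /=; ring.
congr (_ * (_ + _)).
  rewrite (bigD1 k) //= (bigD1 l) //= !eqxx mulr1 !big1 ?addr0 //.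
    by move=> i /negPf ni; rewrite big1 // => j _; rewrite eq_sym ni mulr0.
  by move=> j /negPf nj; rewrite (eq_sym l) nj mulr0.
rewrite (bigD1 l) //= (bigD1 k) //= !eqxx mulr1 !big1 ?addr0 1?mulrC //.
  move=> i /negPf ni; rewrite big1 // => j _.
  by rewrite (eq_sym l) ni andbF mulr0.
by move=> j /negPf nj; rewrite (eq_sym k) nj mulr0.
Qed.

Lemma quad_rankD p q : (quad_rank (p + q) <= quad_rank p + quad_rank q)%N.
Proof. by rewrite /quad_rank linearD /= mxrank_add. Qed.

Lemma quad_rankN q : quad_rank (- q) = quad_rank q.
Proof. by rewrite /quad_rank linearN /= mxrank_opp. Qed.

Lemma quad_rank_lin_mul u v : (quad_rank (lin u * lin v) <= 2)%N.
Proof.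
rewrite /quad_rank quad_mx_lin_mul (leq_trans (mxrank_scale _ _)) //.
rewrite (leq_trans (mxrank_add _ _)) // (@leq_add _ _ 1 1) //;
  exact: leq_trans (mxrankM_maxl _ _) (rank_leq_col _).
Qed.

(** For a square the two outer products share the right factor [u] and merge into one. This saving
    is what gives rank 5 instead of 6 for S1. *)
Lemma quad_rank_lin_sqr u : (quad_rank (lin u * lin u) <= 1)%N.
Proof.
rewrite /quad_rank quad_mx_lin_mul (leq_trans (mxrank_scale _ _)) //.
rewrite -mulmxDl.
exact: leq_trans (mxrankM_maxl _ _) (rank_leq_col _).
Qed.

Lemma lin_homog u : lin u \is 1.-homog.
Proof. by rewrite rpred_sum // => i _; rewrite rpredZ // dhomogX /= mdeg1. Qed.

Lemma lin_mul_homog u v : lin u * lin v \is 2.-homog.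
Proof. exact: (dhomogM (lin_homog u) (lin_homog v)). Qed.

(** A nonconstant monomial of [p] moves [q] to a degree above [d], so only the constant term of [p]
    contributes in degree [d]. *)
Lemma mcoeff_mul_homog d p q (m : 'X_{1..n}) :
  q \is d.-homog -> mdeg m = d -> (p * q)@_m = p@_0 * q@_m.
Proof.
move=> hq dm; elim/mpolyind: p => [|c k p _ _ IHp].
  by rewrite mul0r !mcoeff0 mul0r.
rewrite mulrDl !mcoeffD IHp mulrDl -scalerAl !mcoeffZ mcoeffX; congr (_ + _).
have [->|k0] := eqVneq k 0%MM; first by rewrite mpolyX0 mul1r mulr1.
rewrite mulr0 mul0r (@dhomog_nemf_coeff _ _ mdeg (mdeg k + d)) ?mulr0 //.
  by apply: dhomogM => //; rewrite dhomogX.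
by rewrite /= dm -[X in X == _]add0n eqn_add2r eq_sym mdeg_eq0.
Qed.

(** Replacing every multiplier by its constant term changes nothing in degree 2: the quadrics of the
    ideal are the K-span of its quadratic generators. *)
Lemma ideal_gen_quad G q : (forall g, G g -> g \is 2.-homog) ->
  ideal_gen G q -> q \is 2.-homog ->
  exists2 s : seq (K * {mpoly K[n]}), forall c, c \in s -> G c.2
    & q = \sum_(c <- s) c.1 *: c.2.
Proof.
move=> homG [s sG ->] homq.
exists [seq (c.1@_0, c.2) | c <- s]; first by move=> c /mapP[d /sG Gd ->].
apply/mpolyP => m; rewrite big_map.
have [m2|m2] := eqVneq (mdeg m) 2%N.
  rewrite !raddf_sum /= !big_seq; apply: eq_bigr => c /sG /homG hc.
  by rewrite mcoeffZ (mcoeff_mul_homog _ hc).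
rewrite (dhomog_nemf_coeff homq m2) raddf_sum /= big_seq big1 //.
move=> c /sG /homG hc.
by rewrite mcoeffZ (dhomog_nemf_coeff hc m2) mulr0.
Qed.

(** Since the quadrics of the ideal are spanned by [G], a linear relation between matrix entries
    need only be tested on [G]. *)
Lemma ideal_gen_quad_mx G q (phi : 'M[K]_n -> K) :
  (forall a A B, phi (a *: A + B) = a * phi A + phi B) ->
  (forall g, G g -> g \is 2.-homog) -> (forall g, G g -> phi (quad_mx g) = 0) ->
  ideal_gen G q -> q \is 2.-homog -> phi (quad_mx q) = 0.
Proof.
move=> phiP homG phiG /(ideal_gen_quad homG) /[apply] -[s sG ->].
have phi0 : phi 0 = 0.
  by have := phiP (-1) 0 0; rewrite scaler0 addr0 mulN1r addNr.
elim: s sG => [|c s IHs] sG; first by rewrite big_nil linear0.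
have Gc : G c.2 by apply: sG; rewrite mem_head.
rewrite big_cons linearP phiP (phiG _ Gc).
by rewrite mulr0 add0r IHs // => d ds; apply: sG; rewrite inE ds orbT.
Qed.

Lemma mem_ideal_gen G q : G q -> ideal_gen G q.
Proof.
move=> Gq; exists [:: (1, q)]; first by move=> c; rewrite inE => /eqP ->.
by rewrite big_seq1 mul1r.
Qed.

Lemma ideal_genD G p q : ideal_gen G p -> ideal_gen G q -> ideal_gen G (p + q).
Proof.
move=> [s sG ->] [t tG ->]; exists (s ++ t); last by rewrite big_cat.
by move=> c; rewrite mem_cat => /orP[/sG|/tG].
Qed.

Lemma ideal_genM G p q : ideal_gen G q -> ideal_gen G (p * q).
Proof.
move=> [s sG ->]; exists [seq (p * c.1, c.2) | c <- s].
  by move=> c /mapP[d /sG Gd ->].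
by rewrite big_map mulr_sumr; apply: eq_bigr => c _; rewrite mulrA.
Qed.

Lemma ideal_gen0 G : ideal_gen G 0.
Proof. by exists [::]; rewrite ?big_nil. Qed.

Lemma ideal_genN G q : ideal_gen G q -> ideal_gen G (- q).
Proof. by rewrite -mulN1r; apply: ideal_genM. Qed.

Lemma ideal_gen_sub G H : (forall g, G g -> ideal_gen H g) ->
  forall p, ideal_gen G p -> ideal_gen H p.
Proof.
move=> GH p [s sG ->]; rewrite big_seq; apply: big_ind => [||c /sG /GH].
- exact: ideal_gen0.
- exact: ideal_genD.
- exact: ideal_genM.
Qed.

End QuadMx.

(** * Criterion for lower bounds on the rank index *)

(** Generators of rank below [r] would all have zero entry at [(i, j)]. Taking this entry is linear,
    so it would vanish on every quadric of the ideal, contradicting the given [g]. *)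
Lemma not_generated_in_rank (K : fieldType) n (X : ('I_n.+1 -> K) -> Prop)
    (F : {mpoly K[n.+1]} -> Prop) r i j :
  (forall p, homog_ideal X p <-> ideal_gen F p) ->
  (forall g, F g -> g \is 2.-homog) ->
  (exists2 g, F g & quad_mx g i j != 0) ->
  (forall q, ideal_gen F q -> q \is 2.-homog -> quad_mx q i j != 0 ->
     (r <= quad_rank q)%N) ->
  forall l, generated_in_rank X l -> (r <= l)%N.
Proof.
move=> IX homF [g Fg gij] rankF l [G Gl IG]; rewrite leqNgt; apply/negP => lr.
case/eqP: gij; 
apply: (@ideal_gen_quad_mx _ _ G _ (fun A => A i j)) => [||q Gq||].
- by move=> a A B; rewrite !mxE.
- by move=> q /Gl[].
- have [homq rq] := Gl _ Gq; apply/eqP/negP => /negP /(rankF q).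
  move=> /(_ _ homq) rq'; move: lr; rewrite ltnNge (leq_trans _ rq) // rq' //.
  by apply/IX/IG; apply: mem_ideal_gen.
- by apply/IG/IX; apply: mem_ideal_gen.
- exact: homF.
Qed.

(** Form for concrete submatrices: rows and columns are listed as natural numbers, in the order that
    makes the submatrix triangular. *)
Lemma rank_trig_seq (K : fieldType) n (A : 'M[K]_n.+1) (rs cs : seq nat) :
  (forall i j, (i < j < size rs)%N ->
     A (inord (nth 0%N rs i)) (inord (nth 0%N cs j)) = 0) ->
  (forall i, (i < size rs)%N ->
     A (inord (nth 0%N rs i)) (inord (nth 0%N cs i)) != 0) ->
  (size rs <= \rank A)%N.
Proof.
move=> A0 A1; pose f i : 'I_n.+1 := inord (nth 0%N rs i).
pose g i : 'I_n.+1 := inord (nth 0%N cs i).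
apply: (@rank_trig_submx _ _ _ (size rs) A (fun i => f i) (fun i => g i)).
  by move=> i j ij; rewrite A0 // ij ltn_ord.
by move=> i; apply: A1.
Qed.

(** * Matrices of monomials, scroll equations and antidiagonal sums *)

Section Monomials.

Variables (K : fieldType) (n : nat).
Hypothesis charK : 2%N \notin [pchar K].

Local Notation z := (z K n).

Lemma quad_mx_zz a b k l : (a <= n)%N -> (b <= n)%N -> (k <= n)%N ->
  (l <= n)%N -> quad_mx (z a * z b) (inord k) (inord l) =
  2^-1 * (((a == k) && (b == l))%:R + ((b == k) && (a == l))%:R).
Proof.
move=> an bn kn ln; rewrite /z quad_mxXX // !mxE.
have E x y : (x <= n)%N -> (y <= n)%N ->
    (inord x == inord y :> 'I_n.+1) = (y == x).
  by move=> xn yn; rewrite -val_eqE /= !inordK // eq_sym.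
by rewrite !E.
Qed.

Lemma z_lin a : z a = lin (delta_mx 0 (inord a)).
Proof. by rewrite lin_delta. Qed.

Lemma quad_rank_zz a b : (quad_rank (z a * z b) <= 2)%N.
Proof. by rewrite !z_lin quad_rank_lin_mul. Qed.

Lemma zz_homog a b : z a * z b \is 2.-homog.
Proof. by rewrite !z_lin lin_mul_homog. Qed.

(** The 2 x 2 minor on columns [a] and [b] of the matrix with columns (z_i, z_(i+1)). *)
Definition scroll_eq a b := z a * z b.+1 - z a.+1 * z b.

Lemma scroll_eq_homog a b : scroll_eq a b \is 2.-homog.
Proof. by rewrite rpredB ?zz_homog. Qed.

Lemma quad_rank_scroll_eq a b : (quad_rank (scroll_eq a b) <= 4)%N.
Proof.
apply: leq_trans (quad_rankD _ _) _.
by rewrite quad_rankN (@leq_add _ _ 2 2) ?quad_rank_zz.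
Qed.

(* This is the coefficient of t^(m-4) in q(0, 0, 1, t, t^2, ...) for the
   quadratic form q of the matrix A: it vanishes on the scroll equations. *)
Definition antidiag_sum (m : nat) (A : 'M[K]_n.+1) :=
  \sum_(i < n.+1) \sum_(j < n.+1) [&& 1 < i, 1 < j & i + j == m]%N%:R * A i j.

Lemma antidiag_sumP m a A B :
  antidiag_sum m (a *: A + B) = a * antidiag_sum m A + antidiag_sum m B.
Proof.
rewrite /antidiag_sum mulr_sumr -big_split; apply: eq_bigr => i _ /=.
rewrite mulr_sumr -big_split; apply: eq_bigr => j _ /=.
by rewrite !mxE; ring.
Qed.

HB.instance Definition _ m :=
  GRing.isLinear.Build K 'M[K]_n.+1 K^o _ (antidiag_sum m) (antidiag_sumP m).

Lemma antidiag_sumD m : {morph antidiag_sum m : A B / A + B}.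
Proof. exact: linearD. Qed.

Lemma antidiag_sumB m : {morph antidiag_sum m : A B / A - B}.
Proof. exact: linearB. Qed.

Lemma antidiag_sum_delta m a b : antidiag_sum m (delta_mx a b) =
  [&& 1 < a, 1 < b & a + b == m]%N%:R.
Proof.
rewrite /antidiag_sum (bigD1 a) //= (bigD1 b) //= mxE !eqxx mulr1.
rewrite !big1 ?addr0 // => [i|j] /negPf ni; last by rewrite mxE ni andbF mulr0.
by rewrite big1 // => j _; rewrite mxE ni mulr0.
Qed.

Lemma antidiag_sum_zz m a b : (a <= n)%N -> (b <= n)%N ->
  antidiag_sum m (quad_mx (z a * z b)) = [&& 1 < a, 1 < b & a + b == m]%N%:R.
Proof.
move=> an bn; rewrite /z quad_mxXX // linearZ linearD /= !antidiag_sum_delta.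
rewrite !inordK // (addnC b a).
have -> : [&& 1 < b, 1 < a & a + b == m]%N = [&& 1 < a, 1 < b & a + b == m]%N.
  by rewrite andbCA.
exact: half_double.
Qed.

Lemma antidiag_sum_neq0 m A : antidiag_sum m A != 0 ->
  exists k l, [/\ (1 < k)%N, (1 < l)%N, (k + l)%N = m
                & A (inord k) (inord l) != 0].
Proof.
move=> A0; have /existsP[k /existsP[l]] :
    [exists k : 'I_n.+1, exists l : 'I_n.+1,
       [&& 1 < k, 1 < l & k + l == m]%N && (A k l != 0)].
  apply: contraNT A0; rewrite negb_exists => /forallP A0.
  rewrite /antidiag_sum big1 // => k _; rewrite big1 // => l _.
  have := A0 k; rewrite negb_exists => /forallP /(_ l).
  rewrite negb_and negbK.
  by case: (_ && _) => /= [/eqP->|]; rewrite ?mulr0 ?mul0r.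
case/andP=> /and3P[k1 l1 /eqP kl] Akl; exists k, l.
by rewrite !inord_val.
Qed.

End Monomials.


Lemma first_neq0 (V : nmodType) (f : nat -> V) n j : (j <= n)%N -> f j != 0 ->
  exists m, [/\ (m <= n)%N, f m != 0 & forall i, (i < m)%N -> f i = 0].
Proof.
move=> jn fj; have exf : exists i, f i != 0 by exists j.
case: (ex_minnP exf) => m fm minm; exists m; split=> // [|i].
  exact: leq_trans (minm j fj) jn.
by move=> im; apply/eqP; apply: contraTT im => /minm; rewrite -leqNgt.
Qed.

Lemma quad_mx_entryC (K : fieldType) n (q : {mpoly K[n]}) i j :
  quad_mx q i j = quad_mx q j i.
Proof. by rewrite -{1}quad_mx_sym mxE. Qed.

(* [mxE] would also unfold [quad_mx], hence these restricted forms. *)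
Lemma addmx_entry (V : nmodType) m n (A B : 'M[V]_(m, n)) i j :
  (A + B) i j = A i j + B i j.
Proof. by rewrite mxE. Qed.

Lemma oppmx_entry (V : zmodType) m n (A : 'M[V]_(m, n)) i j :
  (- A) i j = - A i j.
Proof. by rewrite mxE. Qed.

Ltac decide_bools :=
  repeat match goal with
  | |- context [nat_of_bool ?b] =>
      first [ have -> : b = false by lia | have -> : b = true by lia ]
  end.

Ltac linear_entries := by move=> a A B; rewrite ?antidiag_sumP !mxE; ring.

(** Entries of a generator become combinations of Kronecker deltas, which the index bounds in the
    context decide; [ring] then closes the identity. *)
Ltac zz_entries charK :=
  rewrite ?(linearB, linearD) /= ?(addmx_entry, oppmx_entry) 
    !(quad_mx_zz charK) //; try lia;
  decide_bools; rewrite /=; ring.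

(** * Linear relations and lower rank bounds for S1 and S2 *)

Section Surfaces.

Variables (K : fieldType) (e : nat).
Hypothesis charK : 2%N \notin [pchar K].

Local Notation z := (z K e.+2).

Lemma S1_eqs_homog g : @S1_eqs K e g -> g \is 2.-homog.
Proof.
by case=> [[i [j [_ [_ ->]]]]|[i [_ ->]]]; rewrite ?rpredB ?rpredD ?zz_homog.
Qed.

Lemma S2_eqs_homog g : @S2_eqs K e g -> g \is 2.-homog.
Proof.
by case=> [[i [j [_ [_ ->]]]]|[i [_ ->]]]; rewrite ?rpredB ?rpredD ?zz_homog.
Qed.

(** In the generators z_1 occurs only in z_1 z_i with 3 <= i <= e+1, always together with - z_0
    z_(i+1) and z_2 z_(i-1). The last monomial has index sum i+1 and contributes 1 to the
    antidiagonal sum, against 1/2 to the entry (1, i); hence the factor 2. *)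
Lemma S1_entries q (Q := fun i j => quad_mx q (inord i) (inord j)) :
  ideal_gen (@S1_eqs K e) q -> q \is 2.-homog ->
  [/\ Q 0%N 0%N = 0, Q 1%N e.+2 = 0
    & forall j, (j < e.+2)%N -> Q 0%N j.+1 = - Q 1%N j /\
    antidiag_sum j.+1 (quad_mx q) = 2 * Q 1%N j].
Proof.
move=> qS1 homq.
have vanish phi : (forall a A B, phi (a *: A + B) = a * phi A + phi B) ->
    (forall g, S1_eqs g -> phi (quad_mx g) = 0) -> phi (quad_mx q) = 0.
  move=> phiP phiG; exact: (ideal_gen_quad_mx phiP S1_eqs_homog phiG qS1 homq).
split=> [||j je].
- apply: (vanish (fun A => A (inord 0) (inord 0))); first linear_entries.
  by move=> ? [[i [j' [ij [je' ->]]]]|[i [ie ->]]]; zz_entries charK.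
- apply: (vanish (fun A => A (inord 1) (inord e.+2))); first linear_entries.
  by move=> ? [[i [j' [ij [je' ->]]]]|[i [ie ->]]]; zz_entries charK.
(* Each equality is restated as the vanishing of one linear functional, to which [vanish]
   applies. *)
split; apply/eqP; rewrite -subr_eq0 ?opprK; apply/eqP.
  apply: (vanish (fun A => A (inord 0) (inord j.+1) + A (inord 1) (inord j))).
    linear_entries.
  move=> ? [[i [j' [ij [je' ->]]]]|[i [ie ->]]]; first zz_entries charK.
  by case: (eqVneq i j) => [eij|nij]; zz_entries charK.
apply: (vanish (fun A => antidiag_sum j.+1 A - 2 * A (inord 1) (inord j))).
  linear_entries.
move=> ? [[i [j' [ij [je' ->]]]]|[i [ie ->]]].
  (* Both monomials of the minor have index sum [i + j' + 1], so their contributions cancel. *)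
  rewrite linearB /= antidiag_sumB !(antidiag_sum_zz charK) //; try lia.
  by case: (eqVneq (i + j') j) => eij; zz_entries charK.
rewrite !(linearB, linearD) /= !(antidiag_sumB, antidiag_sumD).
rewrite !(antidiag_sum_zz charK) //; try lia.
have n2 := two_neq0 charK.
by case: (eqVneq i j) => eij;
  rewrite ?(addmx_entry, oppmx_entry) !(quad_mx_zz charK) //; try lia;
  decide_bools; rewrite /=; field.
Qed.

(** Here z_1 is multiplied only by z_2, ..., z_e, and each z_1 z_j comes with - z_0 z_(j+2). *)
Lemma S2_entries q (Q := fun i j => quad_mx q (inord i) (inord j)) :
  ideal_gen (@S2_eqs K e) q -> q \is 2.-homog ->
  [/\ Q 0%N 0%N = 0, Q 1%N 0%N = 0, Q 1%N 1%N = 0, Q 1%N e.+1 = 0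
    & Q 1%N e.+2 = 0] /\
  forall j, (j <= e)%N -> Q 0%N j.+2 = - Q 1%N j.
Proof.
move=> qS2 homq.
have vanish phi : (forall a A B, phi (a *: A + B) = a * phi A + phi B) ->
    (forall g, S2_eqs g -> phi (quad_mx g) = 0) -> phi (quad_mx q) = 0.
  move=> phiP phiG; exact: (ideal_gen_quad_mx phiP S2_eqs_homog phiG qS2 homq).
split=> [|j je].
  split; [ apply: (vanish (fun A => A (inord 0) (inord 0)))
         | apply: (vanish (fun A => A (inord 1) (inord 0)))
         | apply: (vanish (fun A => A (inord 1) (inord 1)))
         | apply: (vanish (fun A => A (inord 1) (inord e.+1)))
         | apply: (vanish (fun A => A (inord 1) (inord e.+2))) ];
    try linear_entries; move=> ? [[i [j [ij [je ->]]]]|[i [ie ->]]];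
    zz_entries charK.
apply/eqP; rewrite -subr_eq0 opprK; apply/eqP.
apply: (vanish (fun A => A (inord 0) (inord j.+2) + A (inord 1) (inord j))).
  linear_entries.
move=> ? [[i [j' [ij [je' ->]]]]|[i [ie ->]]]; first zz_entries charK.
by case: (eqVneq i j.+1) => [eij|nij]; zz_entries charK.
Qed.

Lemma S1_rank q j : ideal_gen (@S1_eqs K e) q -> q \is 2.-homog ->
  (j <= e.+2)%N -> quad_mx q (inord 1) (inord j) != 0 -> (5 <= quad_rank q)%N.
Proof.
move=> qS1 homq je qj.
have [m [/= me qm q1]] :=
  first_neq0 (f := fun i => quad_mx q (inord 1) (inord i)) je qj.
have [q00 qe qD] := S1_entries qS1 homq.
have {}me : (m < e.+2)%N.
  by rewrite ltn_neqAle me andbT; apply: contraNneq qm => ->; rewrite qe.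
have [q0m diag_m] := qD m me.
(* The antidiagonal relation supplies the fifth pivot [(k, l)]; as [k] and [l] are at least 2 with
   sum [m + 1], both are less than [m]. *)
have /antidiag_sum_neq0[k [l [k1 l1 kl qkl]]] :
    antidiag_sum m.+1 (quad_mx q) != 0.
  by rewrite diag_m; apply: mulf_neq0 => //; apply: two_neq0.
have q0 i : (i <= m)%N -> quad_mx q (inord 0) (inord i) = 0.
  case: i => // i im; rewrite (qD i _).1; last by lia.
  by rewrite q1 ?oppr0.
have lm : (l < m)%N by lia.
have km : (k < m)%N by lia.
(* Row 0 vanishes up to column [m] and row 1 before column [m]; symmetry gives the zeros in the
   lower rows. The pivots are plus or minus the entry (1, m), except the middle one at [(k, l)]. *)
apply: (@rank_trig_seq _ _ _ [:: 0; 1; k; m; m.+1] [:: m.+1; m; l; 1; 0])%N.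
  move=> [|[|[|[|[|i]]]]] [|[|[|[|[|j']]]]] //= ij;
    first [ by rewrite q0 //; lia
          | by rewrite q1 //; lia
          | by rewrite quad_mx_entryC q0 //; lia
          | by rewrite quad_mx_entryC q1 //; lia
          | by exfalso; lia ].
by move=> [|[|[|[|[|i]]]]] //= _;
  rewrite 1?[quad_mx q _ (inord 0)]quad_mx_entryC
          1?[quad_mx q _ (inord 1)]quad_mx_entryC ?q0m ?oppr_eq0.
Qed.

Lemma S2_rank q j : ideal_gen (@S2_eqs K e) q -> q \is 2.-homog ->
  (j <= e.+2)%N -> quad_mx q (inord 1) (inord j) != 0 -> (4 <= quad_rank q)%N.
Proof.
move=> qS2 homq je qj.
have [m [/= me qm q1]] :=
  first_neq0 (f := fun i => quad_mx q (inord 1) (inord i)) je qj.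
have [[q00 q10 q11 qe1 qe2] qD] := S2_entries qS2 homq.
have {}me : (m <= e)%N.
  have me1 : m != e.+1 by apply: contraNneq qm => ->; rewrite qe1.
  have me2 : m != e.+2 by apply: contraNneq qm => ->; rewrite qe2.
  lia.
(* This puts the entry (1, 1) among the zeros before column [m]. *)
have m2 : (1 < m)%N.
  by move: qm; case: (m) => [|[|//]]; rewrite ?q10 ?q11 eqxx.
have q0 i : (i <= m)%N -> quad_mx q (inord 0) (inord i) = 0.
  case: i => [|[|i]] // im; first by rewrite quad_mx_entryC.
  by rewrite qD ?q1 ?oppr0 //; lia.
apply: (@rank_trig_seq _ _ _ [:: 0; 1; m; m.+2] [:: m.+2; m; 1; 0])%N.
  move=> [|[|[|[|i]]]] [|[|[|[|j']]]] //= ij;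
    first [ by rewrite q0 //; lia
          | by rewrite q1 //; lia
          | by rewrite quad_mx_entryC q0 //; lia
          | by rewrite quad_mx_entryC q1 //; lia
          | by exfalso; lia ].
by move=> [|[|[|[|i]]]] //= _;
  rewrite 1?[quad_mx q _ (inord 0)]quad_mx_entryC
          1?[quad_mx q _ (inord 1)]quad_mx_entryC ?qD ?oppr_eq0.
Qed.

End Surfaces.

(** * Linear relations and lower rank bound for T *)

Section Threefold.

Variables (K : fieldType) (e : nat).
Hypothesis charK : 2%N \notin [pchar K].

Lemma T_eqs_homog g : @T_eqs K e g -> g \is 2.-homog.
Proof.
by case=> [[i [j [_ [_ ->]]]]|[i [_ ->]]]; rewrite ?rpredB ?rpredD ?zz_homog.
Qed.

(** No generator contains a product of two of z_0, z_1, z_2, and z_1 is multiplied only by z_3, ...,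
    z_(e+1). Each z_1 z_j comes with z_0 z_(j+1) and - z_2 z_(j+2). *)
Lemma T_entries q (Q := fun i j => quad_mx q (inord i) (inord j)) :
  ideal_gen (@T_eqs K e) q -> q \is 2.-homog ->
  [/\ forall i j, (i <= 2)%N -> (j <= 2)%N -> Q i j = 0,
      Q 1%N e.+2 = 0, Q 1%N e.+3 = 0,
      forall j, (j <= e.+2)%N -> Q 0%N j.+1 = Q 1%N j
    & forall j, (j <= e.+1)%N -> Q 2%N j.+2 = - Q 1%N j].
Proof.
move=> qT homq.
have vanish phi : (forall a A B, phi (a *: A + B) = a * phi A + phi B) ->
    (forall g, T_eqs g -> phi (quad_mx g) = 0) -> phi (quad_mx q) = 0.
  move=> phiP phiG; exact: (ideal_gen_quad_mx phiP T_eqs_homog phiG qT homq).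
split=> [i j i2 j2|||j je|j je].
- apply: (vanish (fun A => A (inord i) (inord j))); first linear_entries.
  by move=> ? [[i' [j' [ij [je' ->]]]]|[i' [ie ->]]]; zz_entries charK.
- apply: (vanish (fun A => A (inord 1) (inord e.+2))); first linear_entries.
  by move=> ? [[i' [j' [ij [je' ->]]]]|[i' [ie ->]]]; zz_entries charK.
- apply: (vanish (fun A => A (inord 1) (inord e.+3))); first linear_entries.
  by move=> ? [[i' [j' [ij [je' ->]]]]|[i' [ie ->]]]; zz_entries charK.
- apply/eqP; rewrite -subr_eq0; apply/eqP.
  apply: (vanish (fun A => A (inord 0) (inord j.+1) - A (inord 1) (inord j))).
    linear_entries.
  move=> ? [[i [j' [ij [je' ->]]]]|[i [ie ->]]].
    by case: (posnP j) => j0; zz_entries charK.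
  case: (posnP j) => j0; first zz_entries charK.
  by case: (eqVneq i j.+1) => [eij|nij]; zz_entries charK.
- apply/eqP; rewrite -subr_eq0 opprK; apply/eqP.
  apply: (vanish (fun A => A (inord 2) (inord j.+2) + A (inord 1) (inord j))).
    linear_entries.
  move=> ? [[i [j' [ij [je' ->]]]]|[i [ie ->]]]; first zz_entries charK.
  by case: (eqVneq i j.+1) => [eij|nij]; zz_entries charK.
Qed.

Lemma T_rank q j : ideal_gen (@T_eqs K e) q -> q \is 2.-homog ->
  (j <= e.+3)%N -> quad_mx q (inord 1) (inord j) != 0 -> (6 <= quad_rank q)%N.
Proof.
move=> qT homq je qj.
have [m [/= me qm q1]] :=
  first_neq0 (f := fun i => quad_mx q (inord 1) (inord i)) je qj.
have [qlow qe2 qe3 qD0 qD2] := T_entries qT homq.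
have {}me : (m <= e.+1)%N.
  have me1 : m != e.+2 by apply: contraNneq qm => ->; rewrite qe2.
  have me2 : m != e.+3 by apply: contraNneq qm => ->; rewrite qe3.
  lia.
have m3 : (2 < m)%N by rewrite ltnNge; apply: contra qm => m2; rewrite qlow.
have q0 i : (i <= m)%N -> quad_mx q (inord 0) (inord i) = 0.
  case: i => [|i] im; first by rewrite qlow.
  by rewrite qD0 ?q1 //; lia.
have q2 i : (i <= m.+1)%N -> quad_mx q (inord 2) (inord i) = 0.
  case: i => [|[|i]] im; try by rewrite qlow.
  by rewrite qD2 ?q1 ?oppr0 //; lia.
(* Rows 2, 0 and 1 have their first nonzero entries in columns [m + 2], [m + 1] and [m], which
   dictates the order; the last three pivots are their mirror images. *)
apply: (@rank_trig_seq _ _ _ [:: 2; 0; 1; m; m.+1; m.+2]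
  [:: m.+2; m.+1; m; 1; 0; 2])%N.
  move=> [|[|[|[|[|[|i]]]]]] [|[|[|[|[|[|j']]]]]] //= ij;
    first [ by rewrite qlow //; lia
          | by rewrite q0 //; lia
          | by rewrite q2 //; lia
          | by rewrite q1 //; lia
          | by rewrite quad_mx_entryC qlow //; lia
          | by rewrite quad_mx_entryC q0 //; lia
          | by rewrite quad_mx_entryC q2 //; lia
          | by rewrite quad_mx_entryC q1 //; lia
          | by exfalso; lia ].
have q0m : quad_mx q (inord 0) (inord m.+1) = quad_mx q (inord 1) (inord m).
  by apply: qD0; lia.
have q2m : quad_mx q (inord 2) (inord m.+2) = - quad_mx q (inord 1) (inord m).
  by apply: qD2; lia.
by move=> [|[|[|[|[|[|i]]]]]] //= _;
  rewrite 1?[quad_mx q _ (inord 0)]quad_mx_entryC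
          1?[quad_mx q _ (inord 1)]quad_mx_entryC
          1?[quad_mx q (inord m.+2) _]quad_mx_entryC
          ?q0m ?q2m ?oppr_eq0.
Qed.

End Threefold.

(** * Generators of small rank *)

Section Generators.

Variables (K : fieldType) (e : nat).
Hypothesis charK : 2%N \notin [pchar K].

Local Notation z := (z K e.+2).

Lemma S2_eqs_rank g : @S2_eqs K e g -> (quad_rank g <= 4)%N.
Proof.
by case=> [[i [j [_ [_ ->]]]]|[i [_ ->]]]; [exact: quad_rank_scroll_eq|];
  rewrite (leq_trans (quad_rankD _ _)) // quad_rankN;
  rewrite (@leq_add _ _ 2 2) ?quad_rank_zz.
Qed.

Lemma T_eqs_rank g : @T_eqs K e g -> (quad_rank g <= 6)%N.
Proof.
case=> [[i [j [_ [_ ->]]]]|[i [_ ->]]].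
  by apply: (@leq_trans 4); first exact: quad_rank_scroll_eq.
rewrite (leq_trans (quad_rankD _ _)) // quad_rankN (@leq_add _ _ 4 2) //;
  rewrite ?quad_rank_zz //.
by rewrite (leq_trans (quad_rankD _ _)) // (@leq_add _ _ 2 2) ?quad_rank_zz.
Qed.

Definition S1_rank5_eq i : {mpoly K[e.+3]} :=
  (z 2 + z i.-1) * (z 2 + z i.-1) + (z 1 - z i.-2) * (z 3 + z i)
    - z 0 * (z 4 + z i.+1).

(** Q_3 is kept, since its term z_2 z_2 is a square and its rank is already at most 1 + 2 + 2; only
    the Q_i with i >= 4 are replaced. *)
Definition S1_rank5_eqs (p : {mpoly K[e.+3]}) : Prop :=
  [\/ exists i j, [/\ (2 <= i < j)%N, (j <= e.+1)%N & p = scroll_eq K e.+2 i j],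
      p = z 2 * z 2 + z 1 * z 3 - z 0 * z 4
    | exists2 i, (4 <= i <= e.+1)%N & p = S1_rank5_eq i].

Lemma S1_rank5_eqsP g :
  S1_rank5_eqs g -> g \is 2.-homog /\ (quad_rank g <= 5)%N.
Proof.
have quadric (u v w x y : 'rV[K]_e.+3)
      (p := lin u * lin u + lin v * lin w - lin x * lin y) :
    p \is 2.-homog /\ (quad_rank p <= 5)%N.
  split; first by rewrite rpredB ?rpredD ?lin_mul_homog.
  rewrite (leq_trans (quad_rankD _ _)) // quad_rankN.
  rewrite (@leq_add _ _ 3 2) ?quad_rank_lin_mul //.
  rewrite (leq_trans (quad_rankD _ _)) //.
  by rewrite (@leq_add _ _ 1 2) ?quad_rank_lin_mul ?quad_rank_lin_sqr.
case=> [[i [j [_ _ ->]]]|->|[i _ ->]].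
- split; first exact: scroll_eq_homog.
  by apply: (@leq_trans 4); first exact: quad_rank_scroll_eq.
- rewrite !z_lin; exact: quadric.
- rewrite /S1_rank5_eq !z_lin -!linearD -!linearB; exact: quadric.
Qed.

(** The first minor accounts for the second copy of z_2 z_(i+1) in the square and for - z_3 z_i, the
    other one for z_(i+1)^2 and - z_i z_(i+2). *)
Lemma S1_rank5_eqE i : S1_rank5_eq i.+2 =
  z 2 * z 2 + z 1 * z 3 - z 0 * z 4 +
  (z 2 * z i.+1 + z 1 * z i.+2 - z 0 * z i.+3)
  + (scroll_eq K e.+2 2 i - scroll_eq K e.+2 i i.+1).
Proof. by rewrite /S1_rank5_eq /scroll_eq /=; ring. Qed.

(** Each new generator is Q_i plus Q_3 and scroll equations, all of which lie in both generating
    sets up to trivial minors, so the exchange can be inverted. *)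
Lemma S1_ideal_rank5 : (3 <= e)%N ->
  forall p, ideal_gen (@S1_eqs K e) p <-> ideal_gen S1_rank5_eqs p.
Proof.
move=> e3.
(* Equal columns are allowed because i = 4 produces the zero minor on columns 2 and 2. *)
have scroll_mem (G : {mpoly K[e.+3]} -> Prop) i j :
    (forall i j, (2 <= i < j)%N -> (j <= e.+1)%N -> G (scroll_eq K e.+2 i j)) ->
    (2 <= i <= j)%N -> (j <= e.+1)%N -> ideal_gen G (scroll_eq K e.+2 i j).
  move=> Gij /andP[i2]; rewrite leq_eqVlt => /predU1P[->|ij] je.
    by rewrite /scroll_eq mulrC subrr; apply: ideal_gen0.
  by apply: mem_ideal_gen; apply: Gij; rewrite ?i2.
have scroll1 i j : (2 <= i < j)%N -> (j <= e.+1)%N ->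
    S1_eqs (scroll_eq K e.+2 i j) by left; exists i, j.
have scroll5 i j : (2 <= i < j)%N -> (j <= e.+1)%N ->
    S1_rank5_eqs (scroll_eq K e.+2 i j) by constructor 1; exists i, j.
have S1_3 : S1_eqs (z 2 * z 2 + z 1 * z 3 - z 0 * z 4).
  by right; exists 3%N; rewrite /= ltnS (ltnW e3).
have S5_3 : S1_rank5_eqs (z 2 * z 2 + z 1 * z 3 - z 0 * z 4) by constructor 2.
move=> p; split; apply: ideal_gen_sub => {}p.
  case=> [[i [j [ij [je ->]]]]|[i [/andP[i3 ie] ->]]].
    exact/mem_ideal_gen/scroll5.
  case: i i3 ie => [|[|[|[|i]]]] // _ ie; first exact: mem_ideal_gen.
  have -> : z 2 * z i.+3 + z 1 * z i.+4 - z 0 * z i.+4.+1 =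
      S1_rank5_eq i.+4 - (z 2 * z 2 + z 1 * z 3 - z 0 * z 4)
      - (scroll_eq K e.+2 2 i.+2 - scroll_eq K e.+2 i.+2 i.+3).
    by rewrite S1_rank5_eqE; ring.
  apply: ideal_genD; last first.
    apply: ideal_genN; apply: ideal_genD; last apply: ideal_genN;
      by apply: scroll_mem => //; lia.
  apply: ideal_genD; last exact/ideal_genN/mem_ideal_gen.
  by apply: mem_ideal_gen; constructor 3; exists i.+4.
case=> [[i [j [ij je ->]]]|->|[i /andP[i4 ie] ->]].
- exact/mem_ideal_gen/scroll1.
- exact: mem_ideal_gen.
case: i i4 ie => [|[|[|[|i]]]] // _ ie; rewrite S1_rank5_eqE.
apply: ideal_genD; last first.
  by apply: ideal_genD; last apply: ideal_genN; apply: scroll_mem => //; lia.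
apply: ideal_genD; first exact: mem_ideal_gen.
by apply: mem_ideal_gen; right; exists i.+4.
Qed.

End Generators.

(** * The three rank indices *)

Lemma S1_rank_index (K : fieldType) e (X : ('I_e.+3 -> K) -> Prop) :
  2%N \notin [pchar K] -> (3 <= e)%N ->
  (forall p, homog_ideal X p <-> ideal_gen (@S1_eqs K e) p) ->
  is_rank_index X 5.
Proof.
move=> charK e3 IX; split.
  exists (@S1_rank5_eqs K e) => [q /(S1_rank5_eqsP charK)//|p].
  by have := S1_ideal_rank5 charK e3 p; have := IX p; tauto.
(* The entry (1, 3) is 1/2 for Q_3, because of its term z_1 z_3. *)
apply: (not_generated_in_rank (i := inord 1) (j := inord 3) IX).
- exact: S1_eqs_homog.
- exists (z K e.+2 2 * z K e.+2 2 + z K e.+2 1 * z K e.+2 3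
    - z K e.+2 0 * z K e.+2 4).
    by right; exists 3%N; split=> //; lia.
  rewrite !(linearB, linearD) /= !(addmx_entry, oppmx_entry).
  rewrite !quad_mx_zz //; try lia.
  rewrite /= [X in X != 0](_ : _ = 2^-1); last by ring.
  by rewrite invr_eq0 two_neq0.
- by move=> q qS homq; apply: S1_rank => //; lia.
Qed.

Lemma S2_rank_index (K : fieldType) e (X : ('I_e.+3 -> K) -> Prop) :
  2%N \notin [pchar K] -> (3 <= e)%N ->
  (forall p, homog_ideal X p <-> ideal_gen (@S2_eqs K e) p) ->
  is_rank_index X 4.
Proof.
move=> charK e3 IX; split.
  exists (@S2_eqs K e) => // q qS.
  by split; [exact: S2_eqs_homog | exact: S2_eqs_rank].
(* The witness is the generator with i = 3, whose term z_1 z_2 gives the entry 1/2. *)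
apply: (not_generated_in_rank (i := inord 1) (j := inord 2) IX).
- exact: S2_eqs_homog.
- exists (z K e.+2 1 * z K e.+2 2 - z K e.+2 0 * z K e.+2 4).
    by right; exists 3%N; split=> //; lia.
  rewrite !linearB /= !(addmx_entry, oppmx_entry).
  rewrite !quad_mx_zz //; try lia.
  rewrite /= [X in X != 0](_ : _ = 2^-1); last by ring.
  by rewrite invr_eq0 two_neq0.
- by move=> q qS homq; apply: S2_rank => //; lia.
Qed.

Lemma T_rank_index (K : fieldType) e (X : ('I_e.+4 -> K) -> Prop) :
  2%N \notin [pchar K] -> (3 <= e)%N ->
  (forall p, homog_ideal X p <-> ideal_gen (@T_eqs K e) p) ->
  is_rank_index X 6.
Proof.
move=> charK e3 IX; split.
  exists (@T_eqs K e) => // q qT.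
  by split; [exact: T_eqs_homog | exact: T_eqs_rank].
(* The witness is the generator with i = 4, which contains z_1 z_3. *)
apply: (not_generated_in_rank (i := inord 1) (j := inord 3) IX).
- exact: T_eqs_homog.
- exists (z K e.+3 1 * z K e.+3 3 + z K e.+3 0 * z K e.+3 4
    - z K e.+3 2 * z K e.+3 5).
    by right; exists 4%N; split=> //; lia.
  rewrite !(linearB, linearD) /= !(addmx_entry, oppmx_entry).
  rewrite !quad_mx_zz //; try lia.
  rewrite /= [X in X != 0](_ : _ = 2^-1); last by ring.
  by rewrite invr_eq0 two_neq0.
- by move=> q qS homq; apply: T_rank => //; lia.
Qed.

Theorem theorem6p6 (K : closedFieldType) (charK : 2%N \notin [pchar K]%R)
    (e : nat) (e_ge3 : (3 <= e)%N)
    (S1 S2 : ('I_e.+3 -> K) -> Prop) (T : ('I_e.+4 -> K) -> Prop)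
    (varS1 : proj_variety S1) (varS2 : proj_variety S2) (varT : proj_variety T)
    (IS1 : forall p, homog_ideal S1 p <-> ideal_gen (@S1_eqs K e) p)
    (IS2 : forall p, homog_ideal S2 p <-> ideal_gen (@S2_eqs K e) p)
    (IT : forall p, homog_ideal T p <-> ideal_gen (@T_eqs K e) p) :
  is_rank_index S1 5 /\ is_rank_index S2 4 /\ is_rank_index T 6.
Proof.
split; [exact: S1_rank_index|split].
- exact: S2_rank_index.
- exact: T_rank_index.
Qed.
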